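(* Let $n\ge 3$ and let $\overrightarrow{C_n}$ be the directed cycle on $n$ vertices. Then $\overrightarrow{trc}(\overrightarrow{C_n})=\overrightarrow{strc}(\overrightarrow{C_n})$, and this common value equals $3$ if $n=3$, $6$ if $n=4$, and $2n$ if $n\ge 5$.
   Context: The directed cycle $\overrightarrow{C_n}$ has vertices $v_0,\dots,v_{n-1}$ and arcs $v_0v_1,\dots,v_{n-2}v_{n-1},v_{n-1}v_0$. For a strongly connected digraph $D$: a directed path is total-rainbow if its arcs and internal vertices all receive pairwise distinct colours under a total-colouring (colouring of vertices and arcs); $\overrightarrow{trc}(D)$ (resp. $\overrightarrow{strc}(D)$) is the minimum number of colours in a total-colouring such that every ordered pair $(u,v)$ of vertices is joined by a total-rainbow directed $u$–$v$ path (resp. total-rainbow shortest directed $u$–$v$ path). *)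

(* Defs.v *)
From mathcomp Require Import all_boot.
From mathcomp Require Import boolp.

Set Implicit Arguments.
Unset Strict Implicit.
Unset Printing Implicit Defensive.

(* A finite digraph is its arc relation [e : rel V]; [connect e] is the        *)
(* reflexive transitive closure of [e].                                       *)
Section TotalRainbow.
Variables (V : finType) (e : rel V).

Definition strongly_connected : Prop := forall u v : V, connect e u v.

(* The sequence [p] lists the vertices after the initial vertex [u], so that   *)
(* the length of the path is [size p]; the path from [u] to [u] is trivial.    *)
Definition dipath (u v : V) (p : seq V) : Prop :=
  [/\ path e u p, last u p = v & uniq (u :: p)].

Definition shortest_dipath (u v : V) (p : seq V) : Prop :=
  dipath u v p /\ forall q, dipath u v q -> size p <= size q.

Definition internal_vertices (u : V) (p : seq V) : seq V := behead (belast u p).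

Definition path_arcs (u : V) (p : seq V) : seq (V * V) := zip (u :: p) p.

(* The values on the pairs that are not arcs are never used.                   *)
Definition total_colouring (k : nat) := V + V * V -> 'I_k.

Definition total_rainbow k (c : total_colouring k) (u : V) (p : seq V) : Prop :=
  uniq ([seq c (inr a) | a <- path_arcs u p] ++
        [seq c (inl w) | w <- internal_vertices u p]).

Definition total_rainbow_connected k (c : total_colouring k) : Prop :=
  forall u v : V, exists2 p, dipath u v p & total_rainbow c u p.

Definition strongly_total_rainbow_connected k (c : total_colouring k) : Prop :=
  forall u v : V, exists2 p, shortest_dipath u v p & total_rainbow c u p.

Lemma dipath_shortest u v : connect e u v -> exists p, shortest_dipath u v p.
Proof.
move=> /connectP[q0 eq0 ->]; case/shortenP: eq0 => q eq uq _.
have exP : exists m, `[< exists2 p, dipath u (last u q) p & size p = m >].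
  by exists (size q); apply/asboolP; exists q.
case: (ex_minnP exP) => m /asboolP[p dp <-] minp; exists p; split=> // r dr.
by apply: minp; apply/asboolP; exists r.
Qed.

Lemma total_rainbow_inj k (c : total_colouring k) u v p :
  injective c -> dipath u v p -> total_rainbow c u p.
Proof.
move=> c_inj [_ _ /= /andP[nup up]].
rewrite /total_rainbow (map_comp c inr) (map_comp c inl) -map_cat.
rewrite map_inj_uniq // cat_uniq.
apply/and3P; split.
- rewrite map_inj_uniq; last by move=> ? ? [].
  by apply: (@map_uniq _ _ snd); rewrite [map _ _]unzip2_zip /=.
- by apply/hasPn=> _ /mapP[w _ ->]; apply/negP=> /mapP[].
- rewrite map_inj_uniq; last by move=> ? ? [].
  case: p {nup} up => // w p.
  by rewrite /internal_vertices [behead _]/= lastI rcons_uniq => /andP[].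
Qed.

Lemma strongly_total_rainbow_connectedW k (c : total_colouring k) :
  strongly_total_rainbow_connected c -> total_rainbow_connected c.
Proof. by move=> cP u v; have [p [dp _] rp] := cP u v; exists p. Qed.

Lemma strc_exists : strongly_connected -> exists k,
  `[< exists c : total_colouring k, strongly_total_rainbow_connected c >].
Proof.
move=> sc; exists #|{: V + V * V}|; apply/asboolP; exists enum_rank => u v.
have [p sp] := dipath_shortest (sc u v); exists p => //.
exact: total_rainbow_inj enum_rank_inj sp.1.
Qed.

Lemma trc_exists : strongly_connected -> exists k,
  `[< exists c : total_colouring k, total_rainbow_connected c >].
Proof.
move=> /strc_exists[k /asboolP[c cP]]; exists k; apply/asboolP; exists c.
exact: strongly_total_rainbow_connectedW.
Qed.

Definition trc (sc : strongly_connected) : nat := ex_minn (trc_exists sc).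

Definition strc (sc : strongly_connected) : nat := ex_minn (strc_exists sc).

End TotalRainbow.

(* [ordS i] is [i + 1] modulo [n].                                             *)
Definition dicycle (n : nat) : rel 'I_n := [rel i j | j == ordS i].

Lemma dicycle_strongly_connected n : strongly_connected (@dicycle n).
Proof.
move=> u v; rewrite (@eq_connect _ (@dicycle n) (frel (@ordS n))); last first.
  by move=> i j; rewrite /= eq_sym.
have iterE m : val (iter m (@ordS n) u) = (u + m) %% n.
  elim: m => [|m IHm]; first by rewrite addn0 modn_small.
  by rewrite iterS /= IHm -addn1 modnDml addn1 addnS.
suff -> : v = iter (n - u + v) (@ordS n) u by exact: fconnect_iter.
apply/val_inj; rewrite iterE addnA subnKC ?(ltnW (ltn_ord u)) //.
by rewrite modnDl modn_small.
Qed.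

(* Main.v *)
Require Import Defs.
From mathcomp Require Import all_boot.
From mathcomp Require Import boolp.

Set Implicit Arguments.
Unset Strict Implicit.
Unset Printing Implicit Defensive.

(** The longest dipaths of the cycle run from [ordS w] to [w]; such a path
    contains every arc except the one leaving [w], and every vertex except [w]
    and [ordS w] as an internal vertex.  Hence two elements must receive
    different colours as soon as some [w] misses neither of them.  An arc is
    missed by one [w] and a vertex by two, so for [n >= 5] all [2 n] elements
    have different colours, while for [n = 4] only opposite vertices may share
    a colour.  For the upper bounds, all the dipaths are total-rainbow under a
    suitable colouring. *)

Lemma uniq_map_in_inj (T1 T2 : eqType) (f : T1 -> T2) (s : seq T1) :
  uniq (map f s) -> {in s &, injective f}.
Proof.
elim: s => //= z s IHs /andP[fz /IHs injf] x y; rewrite !inE.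
move=> /predU1P[->|xs] /predU1P[->|ys] // fE; last exact: injf.
- by rewrite fE map_f in fz.
- by rewrite -fE map_f in fz.
Qed.

Lemma uniq_leq_card (T : finType) (s : seq T) : uniq s -> size s <= #|T|.
Proof. by move=> /card_uniqP <-; exact: max_card. Qed.

Section Dicycle.
Variable n : nat.
Implicit Types (u v w x : 'I_n) (p : seq 'I_n).

(* [inl x] is the vertex [x] and [inr x] is the arc leaving [x]. *)
Definition element_colour k (c : total_colouring 'I_n k) (a : 'I_n + 'I_n) :=
  match a with inl x => c (inl x) | inr x => c (inr (x, ordS x)) end.

(** An arc is encoded by its tail, so the tails [belast u p] stand for the arcs. *)
Definition path_elements u p : seq ('I_n + 'I_n) :=
  map inr (belast u p) ++ map inl (behead (belast u p)).

Lemma dicycle_path_arcs u p : path (@dicycle n) u p ->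
  path_arcs u p = [seq (x, ordS x) | x <- belast u p].
Proof.
rewrite /path_arcs; elim: p u => //= v p IHp u /andP[/eqP-> {}/IHp IHp].
by rewrite -IHp.
Qed.

Lemma total_rainbowE k (c : total_colouring 'I_n k) u p :
  path (@dicycle n) u p ->
  total_rainbow c u p = uniq (map (element_colour c) (path_elements u p)).
Proof.
move=> up; rewrite /total_rainbow dicycle_path_arcs // map_cat -!map_comp.
by [].
Qed.

Lemma uniq_path_elements u p : uniq (u :: p) -> uniq (path_elements u p).
Proof.
rewrite lastI rcons_uniq => /andP[_ ub]; rewrite cat_uniq.
apply/and3P; split; first by rewrite map_inj_uniq // => ? ? [].
- by apply/hasPn=> _ /mapP[x _ ->]; apply/negP=> /mapP[].
- rewrite map_inj_uniq; last by move=> ? ? [].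
  by case: (belast u p) ub => //= ? ? /andP[].
Qed.

(** Each vertex has a single out-neighbour, so start and length determine a dipath. This turns the
    colourings for [n = 3] and [n = 4] into finite checks. *)
Lemma dicycle_dipath_traject u v p : dipath (@dicycle n) u v p ->
  p = traject (@ordS n) (ordS u) (size p) /\ size p < n.
Proof.
case=> up _ /uniq_leq_card size_p; split; last by rewrite card_ord in size_p.
have /fpathP[m ->] : fpath (@ordS n) u p.
  by rewrite -(@eq_path _ (@dicycle n)) // => x y; rewrite /= eq_sym.
by rewrite size_traject.
Qed.

(** The arc from [w] to [ordS w] closes the path into a cycle, whose vertex set is closed under
    successors; strong connectivity then makes it everything. *)
Lemma dicycle_dipath_spanning w p x : dipath (@dicycle n) (ordS w) w p ->
  x \in ordS w :: p.
Proof.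
case=> path_p last_p _; set q := ordS w :: p.
have cycle_q : cycle (@dicycle n) q.
  by rewrite /= rcons_path path_p last_p /dicycle /= eqxx.
have closed_q y z : y \in q -> dicycle y z -> z \in q.
  move=> yq /eqP->; have /eqP<- := next_cycle cycle_q yq.
  by rewrite mem_next.
have /connectP[r + ->] := dicycle_strongly_connected (ordS w) x.
elim: r (ordS w) (mem_head _ _ : ordS w \in q) => //= z r IHr y yq /andP[yz].
exact/IHr/(closed_q y).
Qed.

(** A vertex [x] is not internal when it is the end of the path, [w = x], or its start,
    [w = ord_pred x]. *)
Definition missed_by (a : 'I_n + 'I_n) : seq 'I_n :=
  match a with inl x => [:: x; ord_pred x] | inr x => [:: x] end.

Lemma mem_path_elements w p a : dipath (@dicycle n) (ordS w) w p ->
  w \notin missed_by a -> a \in path_elements (ordS w) p.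
Proof.
move=> wp; have spanp x : x != w -> x \in belast (ordS w) p.
  have := dicycle_dipath_spanning x wp; case: wp => _ lastp _.
  by rewrite lastI lastp mem_rcons inE => /orP[->|].
case: a => x; rewrite /= !inE mem_cat ?negb_or; last first.
  by rewrite eq_sym => /spanp xb; rewrite map_f.
case/andP=> /[1!eq_sym] /spanp xb wx; rewrite [X in _ || X]map_f ?orbT //.
have xS : x != ordS w by apply: contraNneq wx => ->; rewrite ordSK.
by case: p {wp spanp} xb => //= y p; rewrite inE (negPf xS).
Qed.

Lemma element_colour_inj k (c : total_colouring 'I_n k) a b w :
    total_rainbow_connected (@dicycle n) c ->
    w \notin missed_by a ++ missed_by b ->
  element_colour c a = element_colour c b -> a = b.
Proof.
move=> /(_ (ordS w) w)[p wp rp]; rewrite mem_cat negb_or => /andP[wa wb].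
have [path_p _ _] := wp.
rewrite total_rainbowE // in rp.
by apply: (uniq_map_in_inj rp); apply: mem_path_elements wp _.
Qed.

Lemma leq_total_colouring k (c : total_colouring 'I_n k) D :
    total_rainbow_connected (@dicycle n) c -> uniq D ->
    {in D &, forall a b, exists w, w \notin missed_by a ++ missed_by b} ->
  size D <= k.
Proof.
move=> cP uD sepD.
rewrite -[leqRHS]card_ord -(size_map (element_colour c)).
apply: uniq_leq_card; rewrite map_inj_in_uniq // => a b aD bD.
by have [w wab] := sepD a b aD bD; exact: element_colour_inj cP wab.
Qed.

Lemma ord_notin (s : seq 'I_n) : size s < n -> exists w, w \notin s.
Proof.
move=> ltsn; apply/existsP; apply: contraLR ltsn => /existsPn sP.
rewrite -leqNgt -[n in n <= _]card_ord; apply: leq_trans (card_size s).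
by apply/subset_leq_card/subsetP=> x _; have := sP x; rewrite negbK.
Qed.

(** If all dipaths are rainbow, so are the shortest ones: [N] bounds both numbers from above. The
    lower bound reaches [strc] because a strong colouring is also an ordinary one. *)
Lemma trc_strc_eq N :
    (exists c : total_colouring 'I_n N,
       forall u v p, dipath (@dicycle n) u v p -> total_rainbow c u p) ->
    (forall k (c : total_colouring 'I_n k),
       total_rainbow_connected (@dicycle n) c -> N <= k) ->
  trc (@dicycle_strongly_connected n) = strc (@dicycle_strongly_connected n) /\
  trc (@dicycle_strongly_connected n) = N.
Proof.
move=> [c cP] minN; rewrite /trc /strc.
case: ex_minnP => t /asboolP[ct ctP] mint.
case: ex_minnP => s /asboolP[cs csP] mins.
have cS : strongly_total_rainbow_connected (@dicycle n) c.
  move=> u v; have [p sp] :=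
    dipath_shortest (dicycle_strongly_connected u v).
  by exists p => //; case: sp => /cP.
have Nt := minN _ _ ctP.
have Ns := minN _ _ (strongly_total_rainbow_connectedW csP).
have sN : s <= N by apply: mins; apply/asboolP; exists c.
have tN : t <= N.
  apply: mint; apply/asboolP; exists c.
  exact: strongly_total_rainbow_connectedW.
have -> : t = N by apply/eqP; rewrite eqn_leq tN.
by split=> //; apply/eqP; rewrite eqn_leq Ns.
Qed.

End Dicycle.

Lemma dicycle3_colouring : exists c : total_colouring 'I_3 3,
  forall u v p, dipath (@dicycle 3) u v p -> total_rainbow c u p.
Proof.
(* A vertex takes the colour of the opposite arc, the one missing from any dipath through it. *)
pose c (a : 'I_3 + 'I_3 * 'I_3) := match a with
  | inl x => Ordinal (ltn_pmod x.+1 (isT : 0 < 3))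
  | inr xy => xy.1
  end.
exists c => u v p /dicycle_dipath_traject[-> ltp].
move: (size p) ltp => [|[|[|//]]] _; case: u => [[|[|[|//]]] ltu] //.
Qed.

Lemma dicycle4_colouring : exists c : total_colouring 'I_4 6,
  forall u v p, dipath (@dicycle 4) u v p -> total_rainbow c u p.
Proof.
(* Vertices are coloured by parity: a dipath has at most two internal vertices, and these are
   consecutive. *)
pose c (a : 'I_4 + 'I_4 * 'I_4) := match a with
  | inl x => Ordinal (ltn_pmod (4 + x %% 2) (isT : 0 < 6))
  | inr xy => Ordinal (ltn_pmod xy.1 (isT : 0 < 6))
  end.
exists c => u v p /dicycle_dipath_traject[-> ltp].
move: (size p) ltp => [|[|[|[|//]]]] _; case: u => [[|[|[|[|//]]]] ltu] //.
Qed.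

Lemma dicycle_colouring n : exists c : total_colouring 'I_n (2 * n),
  forall u v p, dipath (@dicycle n) u v p -> total_rainbow c u p.
Proof.
have cardE : #|{: 'I_n + 'I_n}| = 2 * n.
  by rewrite card_sum card_ord mul2n addnn.
pose rank := cast_ord cardE \o enum_rank.
pose c (a : 'I_n + 'I_n * 'I_n) := match a with
  | inl x => rank (inl x)
  | inr xy => rank (inr xy.1)
  end.
exists c => u v p [up _ uup].
rewrite total_rainbowE // (@eq_map _ _ _ rank); last by case.
rewrite map_inj_uniq ?uniq_path_elements //.
exact: inj_comp (@cast_ord_inj _ _ _) enum_rank_inj.
Qed.

Lemma dicycle3_bound k (c : total_colouring 'I_3 k) :
  total_rainbow_connected (@dicycle 3) c -> 3 <= k.
Proof.
move=> cP; pose o i : 'I_3 := Ordinal (ltn_pmod i (isT : 0 < 3)).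
(* These are the elements of the dipath from 0 to 2. *)
apply: (@leq_total_colouring _ _ c [:: inr (o 0); inr (o 1); inl (o 1)]) => //.
move=> a b aD bD; exists (o 2).
by move: aD bD; rewrite !inE => /or3P[] /eqP-> /or3P[] /eqP->.
Qed.

Lemma dicycle4_bound k (c : total_colouring 'I_4 k) :
  total_rainbow_connected (@dicycle 4) c -> 6 <= k.
Proof.
move=> cP; pose o i : 'I_4 := Ordinal (ltn_pmod i (isT : 0 < 4)).
pose D : seq ('I_4 + 'I_4) :=
  map inr (map o (iota 0 4)) ++ [:: inl (o 0); inl (o 1)].
(* A pair with an arc is missed by at most three ends; the adjacent vertices 0 and 1 are missed only
   by 3, 0 and 1. *)
apply: (@leq_total_colouring _ _ c D) => // -[x|x] [y|y] xD yD;
  [exists (o 2) | exact: ord_notin..].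
by move: xD yD; rewrite !inE /= => /orP[] /eqP[->] /orP[] /eqP[->].
Qed.

Lemma dicycle_bound n k (c : total_colouring 'I_n k) : 5 <= n ->
  total_rainbow_connected (@dicycle n) c -> 2 * n <= k.
Proof.
move=> n5 cP; have <- : size (enum {: 'I_n + 'I_n}) = 2 * n.
  by rewrite -cardT card_sum card_ord mul2n addnn.
apply: leq_total_colouring cP (enum_uniq _) _ => a b _ _.
(* Two elements are missed by at most four ends, fewer than [n]. *)
by apply/ord_notin/(leq_trans _ n5); case: a; case: b.
Qed.

Theorem theorem10 (n : nat) (hn : 3 <= n) :
  trc (@dicycle_strongly_connected n) = strc (@dicycle_strongly_connected n) /\
  trc (@dicycle_strongly_connected n) =
    (if n == 3 then 3 else if n == 4 then 6 else 2 * n).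
Proof.
case: n hn => [|[|[|[|[|n]]]]] // _.
- exact: trc_strc_eq dicycle3_colouring dicycle3_bound.
- exact: trc_strc_eq dicycle4_colouring dicycle4_bound.
- by apply: trc_strc_eq (dicycle_colouring _) _ => k c; exact: dicycle_bound.
Qed.
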